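(* For $m,n\geq 1$, $$F_{m+n}^I(x,y,q)=F_m^I(xq^n,yq^{2n},q)F_n^I(x,y,q)+yq^{2(n-1)}F_{m-1}^I(xq^{n+1},yq^{2(n+1)},q)F_{n-1}^I(x,y,q).$$
   Context: $S_n(123,132,213)$ is the set of permutations of $[n]$ with no subsequence order isomorphic to $123$, $132$ or $213$; each such $\pi$ is a concatenation of increasing blocks of size $1$ or $2$, each block larger than all later blocks. $s(\pi)$, $d(\pi)$ are the numbers of maximal increasing runs of $\pi$ of length $1$ and $2$, and $inv(\pi)$ is the number of inversions. $F_n^I(x,y,q)=\sum_{\pi\in S_n(123,132,213)}x^{s(\pi)}y^{d(\pi)}q^{inv(\pi)}$, a polynomial in $x,y,q$; expressions like $F_m^I(xq^n,yq^{2n},q)$ denote substitution. *)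

(* Defs.v *)
From HB Require Import structures.
From mathcomp Require Import all_boot all_order all_algebra all_fingroup.
From mathcomp Require Export mpoly.

Set Implicit Arguments.
Unset Strict Implicit.
Unset Printing Implicit Defensive.

Import GRing.Theory.

(* One-line notation pi_1 ... pi_n, with letters 1, ..., n (elements of 'I_n
   are numbered from 0). *)
Definition one_line (n : nat) (p : 'S_n) : seq nat :=
  [seq (val (p i)).+1 | i <- enum 'I_n].

Definition order_iso (u t : seq nat) : bool :=
  (size u == size t) &&
  [forall i : 'I_(size t), forall j : 'I_(size t),
     (nth 0 u i < nth 0 u j) == (nth 0 t i < nth 0 t j)].

(* The subsequences of w are the mask m w, for m a bit mask on positions. *)
Definition contains (t w : seq nat) : bool :=
  [exists m : (size w).-tuple bool, order_iso (mask m w) t].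

Definition avoids (ts : seq (seq nat)) (w : seq nat) : bool :=
  all (fun t => ~~ contains t w) ts.

Definition Av (n : nat) (ts : seq (seq nat)) : {set 'S_n} :=
  [set p : 'S_n | avoids ts (one_line p)].

(* The l consecutive letters of w from position i on exist and increase. *)
Definition increasing_factor (w : seq nat) (i l : nat) : bool :=
  (i + l <= size w) && sorted ltn (take l (drop i w)).

(* Maximality: the factor extends by one letter neither left nor right. *)
Definition maximal_run (w : seq nat) (i l : nat) : bool :=
  [&& increasing_factor w i l,
      (i == 0) || ~~ increasing_factor w i.-1 l.+1
    & ~~ increasing_factor w i l.+1].

Definition nruns (l : nat) (w : seq nat) : nat :=
  count (fun i => maximal_run w i l) (iota 0 (size w)).

Definition inv (w : seq nat) : nat :=
  #|[set ij : 'I_(size w) * 'I_(size w) |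
      (ij.1 < ij.2) && (nth 0 w ij.2 < nth 0 w ij.1)]|.

Local Open Scope ring_scope.

Definition x : {mpoly int[3]} := 'X_(@Ordinal 3 0 isT).
Definition y : {mpoly int[3]} := 'X_(@Ordinal 3 1 isT).
Definition q : {mpoly int[3]} := 'X_(@Ordinal 3 2 isT).

Definition FI (n : nat) : {mpoly int[3]} :=
  \sum_(p in Av n [:: [:: 1; 2; 3]; [:: 1; 3; 2]; [:: 2; 1; 3]]%N)
    x ^+ nruns 1 (one_line p) * y ^+ nruns 2 (one_line p)
      * q ^+ inv (one_line p).

(* F_n^I(a, b, c): simultaneous substitution of a, b, c for x, y, q. *)
Definition FI_at (n : nat) (a b c : {mpoly int[3]}) : {mpoly int[3]} :=
  FI n \mPo [tuple a; b; c].

(* Main.v *)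
(* A permutation avoids 123, 132 and 213 iff every letter is larger than all the
   letters at distance at least 2 to its right. Hence its word either starts with
   its largest letter n, or with n - 1, n, and deleting this first block gives
     F_n = x q^(n-1) F_(n-1) + y q^(2(n-2)) F_(n-2).
   The theorem follows by induction on m with step 2, since both of its sides
   satisfy this recurrence in m. *)
Require Import Defs.
From HB Require Import structures.
From mathcomp Require Import all_boot all_order all_algebra all_fingroup.
From mathcomp Require Import mpoly.
From mathcomp Require Import zify ring.

Set Implicit Arguments.
Unset Strict Implicit.
Unset Printing Implicit Defensive.

Import GRing.Theory.

(** * Permutations as words *)

Lemma size_one_line n (p : 'S_n) : size (one_line p) = n.
Proof. by rewrite size_map size_enum_ord. Qed.

Lemma nth_one_line n (p : 'S_n) (i : 'I_n) : nth 0%N (one_line p) i = (p i).+1.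
Proof. by rewrite (nth_map i) ?size_enum_ord // nth_ord_enum. Qed.

Lemma one_line_inj n : injective (@one_line n).
Proof.
move=> p1 p2 eq_p; apply/permP => i; apply/val_inj/eq_add_S.
by rewrite -!nth_one_line eq_p.
Qed.

Lemma perm_one_line n (p : 'S_n) : perm_eq (one_line p) (iota 1 n).
Proof.
apply: uniq_perm; rewrite ?iota_uniq //.
  rewrite /one_line map_inj_uniq ?enum_uniq // => i j.
  by move=> /eq_add_S /val_inj /perm_inj.
move=> k; rewrite mem_iota; apply/mapP/idP => [[i _ ->]|].
  by rewrite add1n !ltnS /= ltn_ord.
case: k => // k /andP[_]; rewrite add1n ltnS => lt_kn.
by exists ((p^-1)%g (Ordinal lt_kn)); rewrite ?mem_enum // permKV.
Qed.

Lemma one_line_surj n (w : seq nat) :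
  perm_eq w (iota 1 n) -> exists p : 'S_n, one_line p = w.
Proof.
move=> pw; have sw : size w = n by rewrite (perm_size pw) size_iota.
have uw : uniq w by rewrite (perm_uniq pw) iota_uniq.
have w_nth (i : 'I_n) : (0 < nth 0 w i <= n)%N.
  have : nth 0%N w i \in w by rewrite mem_nth ?sw.
  by rewrite (perm_mem pw) mem_iota add1n ltnS.
(* The default [i] of [insubd] is never reached: letters lie between 1 and n, so their predecessors
   are below n. *)
pose f (i : 'I_n) : 'I_n := insubd i (nth 0 w i).-1.
have fE i : (f i).+1 = nth 0%N w i.
  have /andP[w0 wn] := w_nth i.
  by rewrite /f val_insubd prednK // wn prednK.
have f_inj : injective f.
  move=> i j eq_f; have : nth 0%N w i = nth 0%N w j by rewrite -!fE eq_f.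
  by move/eqP; rewrite nth_uniq ?sw // => /eqP/val_inj.
exists (perm f_inj); apply: (@eq_from_nth _ 0%N); rewrite size_one_line ?sw //.
by move=> i lt_in; rewrite (nth_one_line _ (Ordinal lt_in)) permE fE.
Qed.

(** * Avoidance as a condition on letters at distance at least 2 *)

Fixpoint far_decreasing (w : seq nat) : bool :=
  if w is a :: w' then all (gtn a) (behead w') && far_decreasing w' else true.

(** The middle letter [b] only witnesses that [a] and [c] are not adjacent. Conversely, the
    immediate right neighbour of [a] can always serve as [b]. *)
Lemma far_decreasingP (w : seq nat) :
  reflect (forall a b c, subseq [:: a; b; c] w -> (c < a)%N) (far_decreasing w).
Proof.
elim: w => [|a w IHw] /=; first by constructor.
apply: (iffP andP) => [[/allP aw /IHw fw] a' b c | fw].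
  case: eqVneq => [->|_]; last exact: fw.
  case: w {IHw fw} aw => //= d w aw; case: eqVneq => _ bcw; apply: aw.
    by rewrite sub1seq in bcw.
  by apply: (mem_subseq bcw); rewrite !inE eqxx orbT.
split.
  apply/allP=> c; case: w fw {IHw} => //= b w fw cw.
  by apply: (fw a b c); rewrite !eqxx sub1seq.
apply/IHw => a' b c sub; apply: (fw a' b c).
exact: subseq_trans sub (subseq_cons w a).
Qed.

Lemma containsP (t w : seq nat) :
  reflect (exists2 u, subseq u w & order_iso u t) (contains t w).
Proof.
apply: (iffP existsP) => [[m iso]|[u /subseqP[m sm ->] iso]].
  by exists (mask m w) => //; apply: mask_subseq.
have sm' : size m == size w by apply/eqP.
by exists (Tuple sm').
Qed.

(** Comparisons on the diagonal are false on both sides, so six remain; in this form [lia] can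
    decide order isomorphism. *)
Lemma order_iso3 (a b c d e f : nat) :
  order_iso [:: a; b; c] [:: d; e; f] =
  [&& (a < b) == (d < e), (a < c) == (d < f), (b < a) == (e < d),
      (b < c) == (e < f), (c < a) == (f < d) & (c < b) == (f < e)]%N.
Proof.
rewrite /order_iso eqxx /=.
apply/forallP/idP => [H | /and5P[h1 h2 h3 h4 /andP[h5 h6]] i].
  have H' i j : (i < 3)%N -> (j < 3)%N ->
      (nth 0 [:: a; b; c] i < nth 0 [:: a; b; c] j)%N
        == (nth 0 [:: d; e; f] i < nth 0 [:: d; e; f] j)%N.
    move=> hi hj; exact: (forallP (H (Ordinal hi)) (Ordinal hj)).
  by rewrite (H' 0 1) // (H' 0 2) // (H' 1 0) // (H' 1 2) // (H' 2 0) // (H' 2 1).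
by apply/forallP => j; case: i j => [[|[|[|i]]] hi] [[|[|[|j]]] hj] //=; rewrite !ltnn.
Qed.

Definition patterns : seq (seq nat) :=
  [:: [:: 1; 2; 3]; [:: 1; 3; 2]; [:: 2; 1; 3]]%N.

(* The three patterns are exactly those of size 3 whose first letter is smaller
   than their last one. *)
Lemma avoids_far_decreasing (w : seq nat) :
  uniq w -> avoids patterns w = far_decreasing w.
Proof.
move=> uw; apply/allP/far_decreasingP => [av a b c sub|far t].
  have /= := subseq_uniq sub uw; rewrite !inE => u.
  rewrite ltnNge; apply/negP => le_ac.
  (* Since a < c, the place of b decides the pattern: 123 if between a and c, 132 if above c, 213 if
     below a. *)
  have no t : t \in patterns -> ~~ order_iso [:: a; b; c] t.
    by move=> /av; apply: contra => iso; apply/containsP; exists [:: a; b; c].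
  have := no [:: 1; 2; 3]%N isT; have := no [:: 1; 3; 2]%N isT.
  have := no [:: 2; 1; 3]%N isT; rewrite !order_iso3; lia.
move=> tP; apply/containsP => -[u sub iso].
have su : size u = 3%N.
  by move: tP iso; rewrite /order_iso !inE => /or3P[] /eqP-> /andP[/eqP].
case: u su sub iso => [|a [|b [|c [|]]]] // _ /far lt_ca.
by move: tP; rewrite !inE => /or3P[] /eqP->; rewrite order_iso3; lia.
Qed.

(** * Enumeration of the avoiding words by their first block *)

(* block_words2 n is the pair (block_words n, block_words n.+1). *)
Fixpoint block_words2 (n : nat) : seq (seq nat) * seq (seq nat) :=
  if n is k.+1 then
    let: (u, v) := block_words2 k in
    (v, map (cons k.+2) v ++ map (fun w => [:: k.+1, k.+2 & w]) u)
  else ([:: [::]], [:: [:: 1%N]]).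

Definition block_words (n : nat) : seq (seq nat) := (block_words2 n).1.

Lemma block_wordsSS n :
  block_words n.+2 =
    map (cons n.+2) (block_words n.+1)
      ++ map (fun w => [:: n.+1, n.+2 & w]) (block_words n).
Proof. by rewrite /block_words /=; case: (block_words2 n). Qed.

Lemma nat_ind2 (P : nat -> Prop) :
  P 0%N -> P 1%N -> (forall n, P n -> P n.+1 -> P n.+2) -> forall n, P n.
Proof.
move=> P0 P1 IH n; suff [] : P n /\ P n.+1 by [].
by elim: n => // n [Pn Pn1]; split=> //; apply: IH.
Qed.

Lemma perm_iotaS n (w : seq nat) :
  perm_eq (n.+1 :: w) (iota 1 n.+1) = perm_eq w (iota 1 n).
Proof.
have /permPr -> : perm_eq (iota 1 n.+1) (n.+1 :: iota 1 n).
  by rewrite -(addn1 n) iotaD add1n addn1 cats1 perm_rcons.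
by rewrite perm_cons.
Qed.

Lemma perm_iotaSS n (w : seq nat) :
  perm_eq [:: n.+1, n.+2 & w] (iota 1 n.+2) = perm_eq w (iota 1 n).
Proof.
rewrite -[RHS]perm_iotaS -[RHS]perm_iotaS.
by rewrite -(perm_catCA [:: n.+2] [:: n.+1] w) /=.
Qed.

Lemma perm_iota_lt n (w : seq nat) :
  perm_eq w (iota 1 n) -> {in w, forall c, (0 < c <= n)%N}.
Proof. by move=> pw c; rewrite (perm_mem pw) mem_iota add1n ltnS. Qed.

Lemma mem_block_words n (w : seq nat) :
  (w \in block_words n) = perm_eq w (iota 1 n) && far_decreasing w.
Proof.
elim/nat_ind2: n w => [||n IH0 IH1] w.
- rewrite inE; apply/eqP/andP => [->//|[/perm_size]]; by case: w.
- rewrite inE; apply/eqP/andP => [->//|[pw _]].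
  by move/perm_small_eq: pw => ->.
rewrite block_wordsSS mem_cat; apply/orP/andP => [[]/mapP[v]|[pw]].
- rewrite IH1 => /andP[pv fv] ->; rewrite perm_iotaS pv /= fv andbT; split=> //.
  by apply/allP => c /mem_behead /(perm_iota_lt pv) /andP[].
- rewrite IH0 => /andP[pv fv] ->; rewrite perm_iotaSS pv /= fv andbT; split=> //.
  have v_le := perm_iota_lt pv.
  apply/andP; split; apply/allP => c; first by move/v_le; rewrite /=; lia.
  by move/mem_behead/v_le; rewrite /=; lia.
(* Every letter from the third position on is smaller than a, so n+2 is a or b. If it is b, then a
   <= n+1, which forces n+1 to be a. *)
have := perm_size pw; case: w pw => [|a [|b w]] // pw _ fw.
have le_ab := perm_iota_lt pw.
have [/allP /= lt_wa fbw] := andP fw.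
have /andP[_ fw'] := fbw.
have : n.+2 \in [:: a, b & w] by rewrite (perm_mem pw) mem_iota; lia.
have : n.+1 \in [:: a, b & w] by rewrite (perm_mem pw) mem_iota; lia.
have /andP[_ a_le] := le_ab a (mem_head _ _).
rewrite !inE; case: (eqVneq n.+2 a) => [eq_a _ _|ne_a /=].
  rewrite -eq_a in pw *; left; apply: map_f; rewrite IH1; apply/andP; split=> //.
  by rewrite -perm_iotaS.
move=> n1 n2; have eq_b : b = n.+2.
  by case/orP: n2 => [/eqP//|/lt_wa]; lia.
have eq_a : a = n.+1.
  by case/or3P: n1 => [/eqP//||/lt_wa]; lia.
subst a b; right; apply: (map_f (fun w => [:: n.+1, n.+2 & w])).
by rewrite IH0 -perm_iotaSS pw.
Qed.

Lemma block_words_uniq n : uniq (block_words n).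
Proof.
elim/nat_ind2: n => // n IH0 IH1; rewrite block_wordsSS cat_uniq.
rewrite !map_inj_uniq ?IH0 ?IH1 ?andbT /=; try by move=> ? ? [].
by apply/hasPn => _ /mapP[w _ ->]; apply/mapP => -[v _ []]; lia.
Qed.

(** [one_line] is injective, and its image of the avoiding permutations has the same members as the
    duplicate-free list [block_words n]. *)
Lemma big_Av (R : Type) (idx : R) (op : Monoid.com_law idx) n (f : seq nat -> R) :
  \big[op/idx]_(p in Av n patterns) f (one_line p)
    = \big[op/idx]_(w <- block_words n) f w.
Proof.
rewrite -big_enum /= -(big_map (@one_line n) xpredT f).
apply: perm_big; apply: uniq_perm.
- by rewrite map_inj_uniq ?enum_uniq //; apply: one_line_inj.
- exact: block_words_uniq.
move=> w; rewrite mem_block_words; apply/mapP/andP => [[p]|[pw fw]].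
  rewrite mem_enum inE => av ->; rewrite perm_one_line; split=> //.
  by rewrite -avoids_far_decreasing // (perm_uniq (perm_one_line p)) iota_uniq.
have [p eq_p] := one_line_surj pw; exists p => //.
rewrite mem_enum inE eq_p avoids_far_decreasing //.
by rewrite (perm_uniq pw) iota_uniq.
Qed.

(** * Inversions and runs when a block is put in front *)

Lemma inv_cons a (w : seq nat) :
  Defs.inv (a :: w) = (count (gtn a) w + Defs.inv w)%N.
Proof.
(* As a double sum of indicators, the count splits by taking index 0 off both sums. *)
have invE v : Defs.inv v = (\sum_(i < size v) \sum_(j < size v)
    ((i < j) && (nth 0 v j < nth 0 v i)))%N.
  rewrite /Defs.inv -sum1_card pair_bigA big_mkcond /=; apply: eq_bigr => -[i j] _.
  by rewrite inE /=; case: ifP.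
rewrite !invE /= big_ord_recl; congr (_ + _)%N.
  rewrite big_ord_recl /= add0n -sum1_count (big_nth 0%N) big_mkord [RHS]big_mkcond /=.
  by apply: eq_bigr => j _; case: ifP.
apply: eq_bigr => i _; rewrite big_ord_recl /= add0n.
by apply: eq_bigr.
Qed.

Lemma increasing_factorS a (w : seq nat) i l :
  increasing_factor (a :: w) i.+1 l = increasing_factor w i l.
Proof. by []. Qed.

Lemma nruns_shift a (w : seq nat) l :
  nruns l (a :: w) =
    (maximal_run (a :: w) 0 l
     + count (fun i => maximal_run (a :: w) i.+1 l) (iota 0 (size w)))%N.
Proof. by rewrite /nruns /= -[1%N]addn0 iotaDl count_map. Qed.

Lemma increasing_factor_cons_gt a (w : seq nat) l :
  all (gtn a) w -> increasing_factor (a :: w) 0 l.+2 = false.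
Proof.
case: w => [|b w] //= /andP[ba _].
by rewrite /increasing_factor /= [(a < b)%N]ltnNge (ltnW ba) andbF.
Qed.

(** The descent after [a] makes [a] a run by itself and keeps the first run of [w] from extending to
    the left. *)
Lemma nruns_cons_gt a (w : seq nat) l :
  all (gtn a) w -> nruns l.+1 (a :: w) = ((l == 0) + nruns l.+1 w)%N.
Proof.
move=> aw; rewrite nruns_shift; congr (_ + _)%N.
  case: l => [|l]; last by rewrite /maximal_run increasing_factor_cons_gt.
  by rewrite /maximal_run increasing_factor_cons_gt //= /increasing_factor /= take0.
apply: eq_in_count => -[|i] _ //.
by rewrite /maximal_run !increasing_factorS /= increasing_factor_cons_gt.
Qed.

Lemma nruns_cons2_gt a b (w : seq nat) l :
  (a < b)%N -> all (gtn b) w ->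
  nruns l.+1 [:: a, b & w] = ((l == 1) + nruns l.+1 w)%N.
Proof.
move=> ab bw.
have no k : increasing_factor [:: a, b & w] 0 k.+3 = false.
  have := increasing_factor_cons_gt k bw; rewrite /increasing_factor /= ab.
  by case: (w).
have yes : increasing_factor [:: a, b & w] 0 2.
  by rewrite /increasing_factor /= ab take0.
have yes1 : increasing_factor [:: a, b & w] 0 1.
  by rewrite /increasing_factor /=.
rewrite !nruns_shift /= addnA; congr (_ + _)%N.
  (* Only the run a, b of length 2 starts at position 0 or 1: the single letters a and b extend to
     it, and the descent after b rules out anything longer. *)
  rewrite /maximal_run /= !increasing_factorS.
  by case: l => [|[|l]]; rewrite ?no ?yes ?yes1 ?increasing_factor_cons_gt ?andbF //.
rewrite -[1%N]addn0 iotaDl count_map; apply: eq_in_count => -[|i] _ //=.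
by rewrite /maximal_run !increasing_factorS /= increasing_factor_cons_gt.
Qed.

(** * Weights and the recurrence for F *)

Local Open Scope ring_scope.

Definition weight (w : seq nat) : {mpoly int[3]} :=
  x ^+ nruns 1 w * y ^+ nruns 2 w * q ^+ Defs.inv w.

Lemma FI_sum n : FI n = \sum_(w <- block_words n) weight w.
Proof. exact: (big_Av _ _ weight). Qed.

Lemma weight_nil : weight [::] = 1.
Proof. by rewrite /weight /nruns /= /Defs.inv eq_card0 ?mulr1 // => -[[]]. Qed.

Lemma weight_cons a (w : seq nat) :
  all (gtn a) w -> weight (a :: w) = x * q ^+ size w * weight w.
Proof.
move=> aw; rewrite /weight !nruns_cons_gt // inv_cons.
move: aw; rewrite all_count => /eqP->; rewrite add1n add0n exprS exprD; ring.
Qed.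

(** Both letters of the block form an inversion with each letter of [w], but not with each other. *)
Lemma weight_cons2 a b (w : seq nat) :
  (a < b)%N -> all (gtn a) w ->
  weight [:: a, b & w] = y * q ^+ (2 * size w) * weight w.
Proof.
move=> ab aw; have bw : all (gtn b) w.
  by apply: sub_all aw => c /= /ltn_trans; apply.
rewrite /weight !nruns_cons2_gt // !inv_cons /= [(b < a)%N]ltnNge ltnW //.
move: aw bw; rewrite !all_count => /eqP-> /eqP->.
rewrite add1n !add0n exprS addnA addnn -mul2n exprD; ring.
Qed.

Lemma FI0 : FI 0 = 1.
Proof. by rewrite FI_sum big_seq1 weight_nil. Qed.

Lemma FI1 : FI 1 = x.
Proof. by rewrite FI_sum big_seq1 weight_cons // weight_nil !mulr1. Qed.

Lemma FI_rec n : FI n.+2 = x * q ^+ n.+1 * FI n.+1 + y * q ^+ (2 * n) * FI n.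
Proof.
have all_gt k w : w \in block_words k -> all (gtn k.+1) w.
  rewrite mem_block_words => /andP[pw _]; apply/allP => c.
  by move/(perm_iota_lt pw) => /andP[].
have size_w k w : w \in block_words k -> size w = k.
  by rewrite mem_block_words => /andP[/perm_size -> _]; rewrite size_iota.
rewrite !FI_sum block_wordsSS big_cat !big_map !mulr_sumr /=.
congr (_ + _); apply: eq_big_seq => w ww.
  by rewrite weight_cons ?all_gt // (size_w n.+1).
by rewrite weight_cons2 ?all_gt // (size_w n).
Qed.

Lemma FI_at0 a b c : FI_at 0 a b c = 1.
Proof. by rewrite /FI_at FI0 rmorph1. Qed.

Lemma FI_at1 a b c : FI_at 1 a b c = a.
Proof. by rewrite /FI_at FI1 comp_mpolyXU -tnth_nth. Qed.

(** Substitution is a ring morphism, so the recurrence holds at arbitrary arguments, in particular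
    at both shifted ones of the theorem. *)
Lemma FI_at_rec n a b c :
  FI_at n.+2 a b c =
    a * c ^+ n.+1 * FI_at n.+1 a b c + b * c ^+ (2 * n) * FI_at n a b c.
Proof.
by rewrite /FI_at FI_rec rmorphD !rmorphM !rmorphXn /= !comp_mpolyXU -!tnth_nth.
Qed.

Theorem theorem4p1 (m n : nat) (hm : (1 <= m)%N) (hn : (1 <= n)%N) :
  FI_at (m + n) x y q =
    FI_at m (x * q ^+ n) (y * q ^+ (2 * n)) q * FI_at n x y q
    + y * q ^+ (2 * (n - 1))
      * FI_at (m - 1) (x * q ^+ (n + 1)) (y * q ^+ (2 * (n + 1))) q
      * FI_at (n - 1) x y q.
Proof.
case: n hn => // n _; case: m hm => // m _.
rewrite !subn1 /= addn1.
elim/nat_ind2: m => [||m IH0 IH1].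
(* After the shift of [m] and [n] by one, this case is the recurrence for F_(n+2) itself. *)
- by rewrite FI_at0 FI_at1 add1n FI_at_rec mulr1.
- rewrite !addSn add0n 2!FI_at_rec [FI_at 2 _ _ _]FI_at_rec !FI_at1 !FI_at0.
  move: (FI_at n.+1 _ _ _) (FI_at n _ _ _) => A B; move: x y q => X Y Q.
  rewrite !(mulnC 2) !exprM !exprS; ring.
(* The shifts align the coefficients of the three recurrences: x q^(n+1) q^(m+2) = x q^(n+2) q^(m+1)
   = x q^(m+n+3), and y q^(2(n+1)) q^(2(m+1)) = y q^(2(n+2)) q^(2m) = y q^(2(m+n+2)). *)
rewrite !addSn FI_at_rec -!addSn IH0 IH1 [FI_at m.+3 _ _ _]FI_at_rec.
rewrite [FI_at m.+2 (x * q ^+ n.+2) _ _]FI_at_rec.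
move: (FI_at m.+2 _ _ _) (FI_at m.+1 (x * q ^+ n.+1) _ _) (FI_at m.+1 _ _ _).
move: (FI_at m _ _ _) (FI_at n.+1 _ _ _) (FI_at n _ _ _) => A B C D E F.
move: x y q => X Y Q.
rewrite !(mulnC 2) !mulSn !exprS !exprD !mulnDl !exprD !exprM !exprS.
ring.
Qed.
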